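(* Let $G$ be a (finite) weighted directed graph with nonnegative edge weights, and let $S\subseteq V(G)$ be the initial blue set. Let $G^+$ denote the directed graph obtained from $G$ by retaining exactly those directed edges of positive weight. Then $\operatorname{ept}_{\mathrm{rzf}}(G,S)<\infty$ if and only if every vertex of $G$ is reachable from $S$ by a directed path in $G^+$.
   Context: Randomized zero forcing (RZF): $G$ is a finite directed graph with nonnegative weights $w_{uv}$ on directed edges $(u,v)$, with $w_{uv}=0$ if there is no edge from $u$ to $v$. Start with blue set $B_0=S$. Given the blue set $B_t$, each white vertex $w\notin B_t$ independently becomes blue at round $t+1$ with probability $p_t(w)=\frac{\sum_{u\in B_t}w_{uw}}{\sum_{u\in V(G)}w_{uw}}$ if the denominator is positive, and $p_t(w)=0$ otherwise; blue vertices stay blue forever. This gives $B_{t+1}\supseteq B_t$. Expected propagation time: if it is possible (with positive probability) to color all of $G$ blue starting from $S$, then $\operatorname{ept}_{\mathrm{rzf}}(G,S)$ is the expected value of $\tau=\min\{t: B_t=V(G)\}$; if it is not possible, $\operatorname{ept}_{\mathrm{rzf}}(G,S)=\infty$. A vertex of $S$ is regarded as reachable from $S$. *)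

(* Defs.v *)
From HB Require Import structures.
From mathcomp Require Import all_boot all_order all_algebra.
From mathcomp Require Import all_classical all_reals all_analysis.

Set Implicit Arguments.
Unset Strict Implicit.
Unset Printing Implicit Defensive.

Import Order.TTheory GRing.Theory Num.Theory.

Local Open Scope classical_set_scope.
Local Open Scope ring_scope.

(* Loops are allowed; parallel edges are not (merge them by adding weights). *)
Record wdigraph (R : realType) := WDigraph {
  vert :> finType;
  edge : rel vert;
  weight : vert -> vert -> R;
  weight_ge0 : forall u v, 0 <= weight u v;
  weight_edge0 : forall u v, ~~ edge u v -> weight u v = 0 }.

Section RandomizedZeroForcing.
Context {R : realType} (G : wdigraph R).

Definition force_prob (A : {set G}) (w : G) : R :=
  let total := \sum_(u : G) weight u w in
  if 0 < total then (\sum_(u in A) weight u w) / total else 0.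

Section Process.
Context {d : measure_display} {T : measurableType d} (P : probability T R).
Variable B : nat -> T -> {set G}.

Definition history (t : nat) (h : nat -> {set G}) : set T :=
  [set x | forall i, (i <= t)%N -> B i x = h i].

(* [rzf_indep] is the product rule for every subfamily W of the white vertices,
   under the conditional probability given B_0, ..., B_t and multiplied out by
   the probability of the history, so that null histories impose nothing. For
   singletons W it gives the individual probabilities [force_prob]. *)
Record is_rzf_process (S : {set G}) : Prop := IsRZFProcess {
  rzf_measurable : forall t A, measurable [set x | B t x = A];
  rzf_init : forall x, B 0%N x = S;
  rzf_mono : forall t x, B t x \subset B t.+1 x;
  rzf_indep : forall t h (W : {set G}), W \subset ~: h t ->
    (P (history t h `&` [set x | W \subset B t.+1 x]) =
     P (history t h) * (\prod_(w in W) force_prob (h t) w)%:E)%E }.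

(* The infimum is a minimum when the process ever reaches V(G), and is +oo
   otherwise (infimum of the empty set). *)
Definition prop_time (x : T) : \bar R :=
  ereal_inf [set t%:R%:E | t in [set t : nat | B t x = [set: G]%SET]].

Definition ept_rzf : \bar R :=
  if (0 < P [set x | exists t, B t x = [set: G]%SET])%E
  then (\int[P]_x prop_time x)%E else +oo%E.

End Process.

Definition pos_edge : rel G := [rel u v | edge u v && (0 < weight u v)].

Definition reachable_from (S : {set G}) (v : G) : Prop :=
  exists2 u, u \in S & connect pos_edge u v.

End RandomizedZeroForcing.

(* Every pair (G, S) has an RZF process: Lebesgue measure on [0, 1[ drives the
   trajectory, the current position in the unit interval selecting the next blue
   set and being rescaled within the selected subinterval. *)
Section Existence.
Context {R : realType} (G : wdigraph R) (S : {set G}).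

Let q (A : {set G}) (w : G) : R := if w \in A then 1 else force_prob A w.

Let q_ge0 A w : 0 <= q A w.
Proof.
rewrite /q; case: ifP => // _; rewrite /force_prob; case: ifP => // t0.
by apply: divr_ge0; apply: sumr_ge0 => u _; exact: weight_ge0.
Qed.

Let q_le1 A w : q A w <= 1.
Proof.
rewrite /q; case: ifP => // _; rewrite /force_prob; case: ifP => // t0.
rewrite ler_pdivrMr// mul1r [leRHS](bigID (mem A))/= lerDl.
by rewrite sumr_ge0// => u _; exact: weight_ge0.
Qed.

Let tr (A A' : {set G}) : R :=
  \prod_w (if w \in A' then q A w else 1 - q A w).

Let tr_ge0 A A' : 0 <= tr A A'.
Proof.
by rewrite prodr_ge0// => w _; case: ifP => _; rewrite ?q_ge0// subr_ge0 q_le1.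
Qed.

Let tr_sub A A' : 0 < tr A A' -> A \subset A'.
Proof.
move=> /lt0r_neq0 /prodf_neq0 h; apply/fintype.subsetP => w wA.
by have := h w isT; case: ifP => // _; rewrite /q wA subrr eqxx.
Qed.

Let tr_sum A (W : {set G}) :
  \sum_(A' : {set G} | W \subset A') tr A A' = \prod_(w in W) q A w.
Proof.
transitivity (\prod_w (q A w + (if w \in W then 0 else 1 - q A w))).
  rewrite bigA_distr big_mkcond/=; apply: eq_bigr => A' _.
  case: ifPn => [WA'|/fintype.subsetPn[w wW wA']].
    apply: eq_bigr => w _; case: ifPn => // wA'.
    by rewrite ifN//; apply: contra wA'; exact: (fintype.subsetP WA').
  by rewrite (bigD1 w)//= (negbTE wA') wW mul0r.
rewrite [RHS]big_mkcond/=; apply: eq_bigr => w _.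
by case: ifP => _; rewrite ?addr0// addrC subrK.
Qed.

Let n := #|{: {set G}}|.
Let e (k : nat) : {set G} := nth finset.set0 (enum {: {set G}}) k.
Let ix (A : {set G}) : nat := index A (enum {: {set G}}).

Let eK A : e (ix A) = A.
Proof. by rewrite /e nth_index// mem_enum. Qed.

Let ix_lt A : (ix A < n)%N.
Proof. by rewrite /ix /n cardE index_mem mem_enum. Qed.

Let ixK k : (k < n)%N -> ix (e k) = k.
Proof. by move=> kn; rewrite /ix /e index_uniq ?enum_uniq// -cardE. Qed.

Let f A k : R := \sum_(0 <= i < k) tr A (e i).

Let fS A k : f A k.+1 = f A k + tr A (e k).
Proof. by rewrite /f big_nat_recr. Qed.

Let f_homo A : {homo f A : i j / (i <= j)%N >-> i <= j}.
Proof. by apply: homo_leq => // [x y z|k]; [exact: le_trans|rewrite fS lerDl]. Qed.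

Let f0 A : f A 0 = 0. Proof. by rewrite /f big_nil. Qed.

Let f1 A : f A n = 1.
Proof.
transitivity (\prod_(w in (finset.set0 : {set G})) q A w); last by rewrite big_set0.
rewrite -tr_sum (eq_bigl xpredT); last by move=> A'; rewrite finset.sub0set.
by rewrite /f /e /n cardE -(big_nth _ xpredT (tr A)) big_enum.
Qed.

Let idx A (u : R) : nat := find (fun k => u < f A k.+1) (iota 0 n).

Let idxP A u : 0 <= u < 1 ->
  [/\ (idx A u < n)%N, f A (idx A u) <= u & u < f A (idx A u).+1].
Proof.
move=> /andP[u0 u1]; have n0 : (0 < n)%N := leq_ltn_trans (leq0n _) (ix_lt A).
have hs : has (fun k => u < f A k.+1) (iota 0 n).
  apply/hasP; exists n.-1; first by rewrite mem_iota /= add0n prednK.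
  by rewrite prednK// f1.
have kn : (idx A u < n)%N by rewrite -[ltnRHS](size_iota 0) -has_find.
split => //; last by have := nth_find 0 hs; rewrite nth_iota.
move: kn; rewrite -/(idx A u); case E : (idx A u) => [|k] kn; first by rewrite f0.
have /(before_find 0) : (k < idx A u)%N by rewrite E.
by rewrite nth_iota ?add0n ?(ltnW kn)// => /negbT; rewrite -leNgt.
Qed.

Let idx_uniq A u k : 0 <= u < 1 -> f A k <= u -> u < f A k.+1 -> idx A u = k.
Proof.
move=> u01 fk fk1; have [_ fi fi1] := idxP A u01; apply/eqP; rewrite eqn_leq.
rewrite -ltnS -[X in _ && X]ltnS; apply/andP; split; rewrite ltnNge; apply/negP.
  by move=> /(f_homo A) /(lt_le_trans fk1) /lt_le_trans /(_ fi); rewrite ltxx.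
by move=> /(f_homo A) /(lt_le_trans fi1) /lt_le_trans /(_ fk); rewrite ltxx.
Qed.

Let next (s : {set G} * R) : {set G} * R :=
  let k := idx s.1 s.2 in (e k, (s.2 - f s.1 k) / tr s.1 (e k)).
Let clamp (x : R) : R := if 0 <= x < 1 then x else 0.
Let st t x : {set G} * R := iter t next (S, clamp x).
Let B t x : {set G} := (st t x).1.

Let next01 s : 0 <= s.2 < 1 ->
  0 < tr s.1 (next s).1 /\ 0 <= (next s).2 < 1.
Proof.
move=> s01; have [_ a b] := idxP s.1 s01.
have t0 : 0 < tr s.1 (next s).1.
  by have := le_lt_trans a b; rewrite fS ltrDl.
split=> //=; rewrite divr_ge0 ?subr_ge0 ?(ltW t0)//=.
by rewrite ltr_pdivrMr// mul1r ltrBlDl -fS.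
Qed.

Let st01 t x : 0 <= (st t x).2 < 1.
Proof.
elim: t => [|t IH]; last by have [] := next01 IH.
by rewrite /= /clamp; case: ifP => //; rewrite lexx ltr01.
Qed.

Let nextE s A' (x y : R) : 0 <= s.2 < 1 -> 0 <= x -> y <= 1 ->
  ((next s).1 = A' /\ x <= (next s).2 < y) <->
  f s.1 (ix A') + tr s.1 A' * x <= s.2 < f s.1 (ix A') + tr s.1 A' * y.
Proof.
move=> s01 x0 y1; have [t0 _] := next01 s01; have [kn a b] := idxP s.1 s01.
have key : 0 < tr s.1 A' ->
    (f s.1 (ix A') + tr s.1 A' * x <= s.2 < f s.1 (ix A') + tr s.1 A' * y) =
    (x <= (s.2 - f s.1 (ix A')) / tr s.1 A' < y).
  move=> t1; rewrite ler_pdivlMr// ltr_pdivrMr// lerBrDl ltrBlDl.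
  by rewrite ![_ * tr _ _]mulrC.
split=> [[E c]|].
  by rewrite key -E// [in ix _]/= ixK.
move=> /[dup] /andP[c1 c2] c.
have t1 : 0 < tr s.1 A'.
  rewrite lt0r tr_ge0 andbT; apply/eqP => z.
  by move: (le_lt_trans c1 c2); rewrite z !mul0r ltxx.
have E : idx s.1 s.2 = ix A'.
  apply: idx_uniq => //; first by rewrite (le_trans _ c1)// lerDl mulr_ge0.
  by rewrite fS eK (lt_le_trans c2)// lerD2l ler_piMr.
by move: c; rewrite key//= E eK.
Qed.

Let f01 A A' : 0 <= f A (ix A') /\ f A (ix A') + tr A A' <= 1.
Proof.
split; first by rewrite -(f0 A) f_homo.
by rewrite -(f1 A) -{2}(eK A') -fS f_homo// ix_lt.
Qed.

Let scale01 A A' z : 0 <= z <= 1 -> 0 <= f A (ix A') + tr A A' * z <= 1.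
Proof.
move=> /andP[z0 z1]; have [a b] := f01 A A'.
by rewrite addr_ge0 ?mulr_ge0//= (le_trans _ b)// lerD2l ler_piMr.
Qed.

Let mass t (h : nat -> {set G}) : R :=
  (h 0%N == S)%:R * \prod_(i < t) tr (h i) (h i.+1).

Let mass_ge0 t h : 0 <= mass t h.
Proof. by rewrite mulr_ge0 ?ler0n// prodr_ge0. Qed.

Let histE t h : exists a, [/\ 0 <= a, a + mass t h <= 1 &
  forall o x y, 0 <= o < 1 -> 0 <= x <= 1 -> 0 <= y <= 1 ->
  (history B t h o /\ x <= (st t o).2 < y) <->
  a + mass t h * x <= o < a + mass t h * y].
Proof.
elim: t => [|t [a [a0 a1 IH]]].
  exists 0; rewrite /mass big_ord0 mulr1; case: eqVneq => [h0|h0].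
    rewrite add0r; split => // o x y o01 x01 y01; rewrite !mul1r !add0r /= /clamp o01.
    by split=> [[]//|]; split=> // i; rewrite leqn0 => /eqP ->.
  rewrite addr0 ler01; split => // o x y o01 x01 y01; rewrite !mul0r !add0r.
  split=> [[/(_ 0%N isT) E]|/andP[a b]]; first by move: h0; rewrite -E eqxx.
  by move: (le_lt_trans a b); rewrite ltxx.
pose c := f (h t) (ix (h t.+1)); pose p := tr (h t) (h t.+1).
have [c0 c1] := f01 (h t) (h t.+1).
have mE : mass t.+1 h = mass t h * p by rewrite /mass big_ord_recr/= mulrA.
exists (a + mass t h * c); split.
- by rewrite addr_ge0// mulr_ge0.
- rewrite mE -addrA -mulrDr (le_trans _ a1)// lerD2l ler_piMr//.
- move=> o x y o01 x01 y01; have zE z : a + mass t h * c + mass t.+1 h * z = a + mass t h * (c + p * z).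
    by rewrite mE -addrA -mulrA -mulrDr.
  rewrite !zE; apply: (iff_trans _ (IH _ _ _ o01 (scale01 _ _ x01) (scale01 _ _ y01))).
  split=> [[H]|].
  + have Et : (st t o).1 = h t by exact: (H t (leqnSn t)).
    move=> xy; split; first by move=> i it; exact: H (leqW it).
    rewrite -Et; apply/nextE; rewrite ?st01//; try by case/andP: x01.
      by case/andP: y01.
    by split=> //; exact: (H t.+1 (leqnn _)).
  + move=> [H]; have Et : (st t o).1 = h t by exact: (H t (leqnn t)).
    rewrite -Et => /nextE[]; rewrite ?st01//; try by case/andP: x01.
      by case/andP: y01.
    move=> E xy; split=> // i; rewrite leq_eqVlt ltnS => /predU1P[->//|].
    exact: H.
Qed.

Let m_cst (Q : Prop) : measurable [set _ : R | Q].
Proof.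
have [q1|q1] := pselect Q.
  by rewrite (_ : [set _ | _] = setT)//; apply/seteqP; split.
by rewrite (_ : [set _ | _] = set0)//; apply/seteqP; split.
Qed.

Let m_st t A (x y : R) : 0 <= x <= 1 -> 0 <= y <= 1 ->
  measurable [set o | (st t o).1 = A /\ x <= (st t o).2 < y].
Proof.
elim: t A x y => [|t IH] A x y x01 y01.
  have -> : [set o | (st 0%N o).1 = A /\ x <= (st 0%N o).2 < y] =
      [set _ | S = A] `&` ((`[0, 1[ `&` `[x, y[) `|`
        (~` `[0, 1[ `&` [set _ | x <= 0 < y])).
    apply/seteqP; split=> o /=; rewrite /clamp !in_itv/=.
      case=> ->; case: ifP => [|/negP] oI xy; split=> //; first by left.
      by right.
    by case=> -> [[->]//|[/negP/negbTE ->]].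
  apply: measurableI; first exact: m_cst.
  apply: measurableU; apply: measurableI => //.
  by apply: measurableC.
rewrite (_ : [set _ | _] = \bigcup_(A0 in [set: {set G}])
  [set o | (st t o).1 = A0 /\
    f A0 (ix A) + tr A0 A * x <= (st t o).2 < f A0 (ix A) + tr A0 A * y]).
  by apply: fin_bigcup_measurable => // A0 _; apply: IH; exact: scale01.
case/andP: x01 => x0 _; case/andP: y01 => _ y1.
apply/seteqP; split => o /=.
  by move=> /(nextE _ (st01 t o) x0 y1) H; exists (st t o).1.
by move=> [A0 _ /= [<-]] /(nextE _ (st01 t o) x0 y1).
Qed.

Let m_B t A : measurable [set o | B t o = A].
Proof.
rewrite (_ : [set _ | _] = [set o | (st t o).1 = A /\ 0 <= (st t o).2 < 1]).
  by apply: m_st; rewrite lexx ler01.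
by apply/seteqP; split=> o /= => [<-|[]//]; rewrite st01.
Qed.

Let m_hist t h : measurable (history B t h).
Proof.
rewrite (_ : history B t h = \bigcap_(i in [set i | (i <= t)%N]) [set o | B i o = h i]).
  by apply: bigcap_measurableType => i _; exact: m_B.
by [].
Qed.

Let m01 : measurable (`[0, 1[%classic : set R). Proof. exact: measurable_itv. Qed.
Let U := mrestr (@lebesgue_measure R) m01.

Let U1 : U setT = 1%E.
Proof.
by rewrite /U /mrestr setTI lebesgue_measure_itv/= lte_fin ltr01 sube0.
Qed.

Let UP : probability (measurableTypeR R) R :=
  HB.pack_for (probability (measurableTypeR R) R) (mrestr (@lebesgue_measure R) m01)
    (Measure_isProbability.Build _ _ _ U U1).

Let U_hist t h : U (history B t h) = (mass t h)%:E.
Proof.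
have [a [a0 a1 H]] := histE t h; have m0 := mass_ge0 t h.
rewrite /U /mrestr (_ : _ `&` _ = `[a, a + mass t h[%classic); last first.
  apply/seteqP; split=> o /=; rewrite !in_itv/=.
    move=> [ho o01]; have := (H o 0 1 o01); rewrite mulr0 mulr1 addr0.
    by rewrite !lexx ler01 => /(_ isT isT)[+ _]; apply; rewrite st01.
  move=> /[dup] /andP[oa ob] oab; have o01 : 0 <= o < 1.
    by rewrite (le_trans a0)// (lt_le_trans ob).
  have := (H o 0 1 o01); rewrite mulr0 mulr1 addr0.
  by rewrite !lexx ler01 => /(_ isT isT)[_ /(_ oab)[]].
rewrite lebesgue_measure_itv/= lte_fin ltrDl.
case: ifPn => [_|]; first by rewrite -EFinB addrAC subrr add0r.
by rewrite -leNgt => m1; congr EFin; apply/eqP; rewrite eq_le m0.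
Qed.

Lemma rzf_process_exists :
  exists (P : probability (measurableTypeR R) R) (B : nat -> R -> {set G}),
    is_rzf_process P B S.
Proof.
exists UP, B; split=> [| |t x|t h W Wh].
- exact: m_B.
- by [].
- by have [/tr_sub] := next01 (st01 t x).
pose h' (A : {set G}) i := if (i <= t)%N then h i else A.
pose F (A : {set G}) := history B t.+1 (h' A) `&` [set _ | W \subset A].
have -> : history B t h `&` [set x | W \subset B t.+1 x] =
    \bigcup_(A in [set: {set G}]) F A.
  apply/seteqP; split=> o /=.
    move=> [ho Wo]; exists (B t.+1 o) => //; split=> // i it; rewrite /h'.
    by case: leqP => [/ho//|ti]; congr (B _ o); apply/eqP; rewrite eqn_leq it ti.
  move=> [A _ [/= Ho WA]]; split.
    by move=> i it; rewrite Ho ?(leqW it)// /h' it.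
  by rewrite Ho// /h' ltnn.
have mF A : measurable (F A) by apply: measurableI => //; exact: m_cst.
have tF : trivIset setT F.
  move=> A1 A2 _ _ [x [[/= H1 _] [/= H2 _]]].
  by have := H1 t.+1 (leqnn _); rewrite H2// /h' ltnn.
rewrite (measure_fin_bigcup UP finite_finset tF (fun A _ => mF A)).
have UF A : UP (F A) = (if W \subset A then mass t h * tr (h t) A else 0)%:E.
  rewrite /F; case: ifP => WA; last first.
    by rewrite (_ : [set _ | _] = set0) ?setI0 ?measure0// -subset0.
  rewrite (_ : [set _ | _] = setT); last by apply/seteqP; split.
  rewrite setIT [UP _]U_hist /mass big_ord_recr/= mulrA; congr (_ * _ * _)%:E.
    by apply: eq_bigr => i _; rewrite /h' (ltnW (ltn_ord i)) ltn_ord.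
  by rewrite /h' leqnn ltnn.
rewrite (fsbigE (enum {: {set G}})) ?enum_uniq//=; last first.
  by move=> A _; rewrite mem_enum.
rewrite (eq_bigr _ (fun A _ => UF A)).
rewrite big_enum_cond/= sumEFin -big_mkcondr/=.
transitivity ((mass t h * \prod_(w in W) force_prob (h t) w)%:E); last first.
  by rewrite EFinM -U_hist.
congr EFin.
rewrite [X in _ = _ * X](eq_bigr (q (h t))); last first.
  move=> w wW; rewrite /q ifN//.
  by have := fintype.subsetP Wh w wW; rewrite inE.
rewrite -tr_sum big_distrr/=; apply: eq_bigl => A.
by rewrite in_setT.
Qed.

End Existence.

(* Main.v *)
(* The probability that w is blue at round t+1 is the sum over A of
   P(B_t = A) q(A, w), where q(A, w) is 1 on A and the forcing probability off A.
   If v is unreachable, induction on t shows that v is almost surely never blue,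
   so G is almost surely never all blue.
   If every vertex is reachable, every A <> V(G) containing S has a white vertex
   of positive forcing probability, so the total forcing probability of the white
   vertices is at least some q > 0 independent of A. Hence E|B_t| grows by at
   least q P(B_t <> V(G)) at round t, and since E|B_t| <= |V(G)| the sum of the
   P(B_t <> V(G)), which is the expectation of the propagation time, is at most
   |V(G)| / q. *)
Require Import Defs.
From mathcomp Require Import all_boot all_order all_algebra.
From mathcomp Require Import all_classical all_reals all_analysis.

Set Implicit Arguments.
Unset Strict Implicit.
Unset Printing Implicit Defensive.

(** * Splitting a measure along a finite-valued map *)

Section FiniteValuedMaps.
Local Open Scope classical_set_scope.
Local Open Scope ring_scope.
Import Order.TTheory GRing.Theory Num.Theory.

Lemma measure_fibers (R : realType) (d : measure_display)
    (T : measurableType d) (mu : {measure set T -> \bar R})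
    (I : finType) (X : T -> I) (E : set T) :
  (forall i, measurable [set x | X x = i]) -> measurable E ->
  mu E = (\sum_(i : I) mu (E `&` [set x | X x = i]))%E.
Proof.
move=> mX mE; pose F i := E `&` [set x | X x = i].
have EF : E = \bigcup_(i in [set: I]) F i.
  by apply/seteqP; split=> [x Ex|x [i _ []]]//; exists (X x).
have mF i : measurable (F i) by exact: measurableI.
have tF : trivIset setT F by move=> i j _ _ [x [[_ /= <-] [_ /= <-]]].
rewrite [in LHS]EF (measure_fin_bigcup mu finite_finset tF (fun i _ => mF i)).
rewrite (fsbigE (enum I)) ?enum_uniq//=; last by move=> i _; rewrite mem_enum.
by rewrite big_enum_cond/=; apply: eq_bigl => i; rewrite in_setT.
Qed.

End FiniteValuedMaps.

Section Process.
Local Open Scope classical_set_scope.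
Local Open Scope ring_scope.
Import Order.TTheory GRing.Theory Num.Theory.

Context {R : realType} {G : wdigraph R}.

(** * Forcing probabilities and positive edges *)

Lemma force_prob_ge0 (A : {set G}) w : 0 <= force_prob A w.
Proof.
rewrite /force_prob; case: ifP => // t0.
by apply: divr_ge0; apply: sumr_ge0 => u _; exact: weight_ge0.
Qed.

Lemma force_prob_gt0 (A : {set G}) u w :
  u \in A -> pos_edge u w -> 0 < force_prob A w.
Proof.
move=> uA /andP[_ uw]; have w0 := @weight_ge0 R G.
have h (Q : pred G) : Q u -> 0 < \sum_(u | Q u) weight u w.
  by move=> Qu; rewrite (bigD1 u)//= ltr_pwDl// sumr_ge0.
by rewrite /force_prob h// divr_gt0// h.
Qed.

Lemma force_prob_eq0 (A : {set G}) w :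
  (forall u, u \in A -> ~~ pos_edge u w) -> force_prob A w = 0.
Proof.
move=> h; rewrite /force_prob; case: ifP => // _.
rewrite big1 ?mul0r// => u /h; rewrite negb_and => /orP[|].
  exact: weight_edge0.
by move=> n0; apply/eqP; rewrite eq_le weight_ge0 leNgt n0.
Qed.

(** A positive-weight path from [S] to a vertex outside [A] starts inside [A], so some edge of it
    leaves [A]; the head of the first such edge is the required [w]. *)
Lemma reachable_progress (S A : {set G}) :
  (forall v, reachable_from S v) -> S \subset A -> A != [set: G]%SET ->
  exists2 w, w \notin A & 0 < force_prob A w.
Proof.
move=> hr /fintype.subsetP SA; rewrite -finset.subTset => /fintype.subsetPn[v _ vA].
have [u uS /connectP[p]] := hr v.
elim: p u {uS}(SA u uS) => [|x p IH] u uA /= => [_ E|/andP[ux xp] E].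
  by move: vA; rewrite E uA.
have [xA|xA] := boolP (x \in A); first exact: (IH x).
by exists x => //; exact: force_prob_gt0 ux.
Qed.

(** The conditional probability that [w] is blue after the next round when the current blue set is
    [A]. *)
Definition stay_prob (A : {set G}) (w : G) : R :=
  if w \in A then 1 else force_prob A w.

Lemma sum_stay_prob (A : {set G}) :
  \sum_w stay_prob A w = #|A|%:R + \sum_(w | w \notin A) force_prob A w.
Proof.
rewrite (bigID (mem A))/= /stay_prob; congr (_ + _).
  rewrite (eq_bigr (fun=> 1)); last by move=> w ->.
  by rewrite sumr_const.
by apply: eq_bigr => w /negbTE ->.
Qed.

(** * Distribution of the blue set at a fixed round *)

Context {d : measure_display} {T : measurableType d} (P : probability T R).
Context (B : nat -> T -> {set G}) (S : {set G}) (hB : is_rzf_process P B S).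

Let mB := rzf_measurable hB.

Lemma measurable_blue t (Q : {set G} -> Prop) : measurable [set x | Q (B t x)].
Proof.
rewrite (_ : [set _ | _] = \bigcup_(A in [set A | Q A]) [set x | B t x = A]).
  by apply: fin_bigcup_measurable => // A _; exact: mB.
by apply/seteqP; split=> [x Qx|x [A QA /= ->]]//; exists (B t x).
Qed.

Lemma blue_sub x s t : (s <= t)%N -> B s x \subset B t x.
Proof.
elim: t => [|t IH]; first by rewrite leqn0 => /eqP ->.
rewrite leq_eqVlt => /predU1P[->//|/IH/fintype.subset_trans]; apply.
exact: rzf_mono hB t x.
Qed.

Definition pr t A := fine (P [set x | B t x = A]).
(** Summed over [w], this gives the expected size of the blue set. *)
Definition cover t w := fine (P [set x | w \in B t x]).
(** The tail probability that the propagation time exceeds [t]. *)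
Definition unfinished t := fine (P [set x | B t x <> [set: G]%SET]).

Lemma pr_ge0 t A : 0 <= pr t A.
Proof. by rewrite fine_ge0. Qed.

Lemma fine_prob_fibers (I : finType) (X : T -> I) (E : set T) :
  (forall i, measurable [set x | X x = i]) -> measurable E ->
  fine (P E) = \sum_i fine (P (E `&` [set x | X x = i])).
Proof.
move=> mX mE; rewrite (measure_fibers P mX mE) sum_fine// => i _.
by apply: fin_num_measure; exact: measurableI.
Qed.

Lemma pr_set t (Q : pred {set G}) :
  fine (P [set x | Q (B t x)]) = \sum_(A | Q A) pr t A.
Proof.
rewrite (fine_prob_fibers (mB t) (measurable_blue t Q)) [RHS]big_mkcond.
apply: eq_bigr => A _; case: ifP => QA.
  by congr (fine (P _)); apply/seteqP; split=> x /= => [[]//|E]; rewrite E.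
rewrite (_ : _ `&` _ = set0) ?measure0//; apply/seteqP; split=> x //= [].
by move=> + E; rewrite E QA.
Qed.

Lemma pr_eq0 t (A : {set G}) : ~~ (S \subset A) -> pr t A = 0.
Proof.
move=> SA; rewrite /pr (_ : [set _ | _] = set0) ?measure0//.
apply/seteqP; split=> x //= E; move: SA.
by rewrite -E -(rzf_init hB x) blue_sub.
Qed.

Lemma coverE t w : cover t w = \sum_A pr t A * (w \in A)%:R.
Proof.
rewrite /cover (pr_set t (fun A => w \in A)) big_mkcond.
by apply: eq_bigr => A _; case: ifP => _; rewrite ?mulr1 ?mulr0.
Qed.

(** * One-round transition probabilities *)

Lemma measurable_history t h : measurable (history B t h).
Proof.
rewrite (_ : history B t h =
    \bigcap_(i in [set i | (i <= t)%N]) [set x | B i x = h i]) //.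
by apply: bigcap_measurableType => i _; exact: mB.
Qed.

(** [rzf_indep] fixes the whole history, while here only the blue set at round [t] is fixed. Summing
    over histories works because each one ending in [A] carries the same factor [force_prob A w],
    and the others contribute zero. *)
Lemma markov_step t (A : {set G}) w : w \notin A ->
  fine (P ([set x | B t x = A] `&` [set x | w \in B t.+1 x])) =
  pr t A * force_prob A w.
Proof.
(* Histories up to [t] are coded as finite functions, so that there are finitely many; the values of
   [hh f] beyond [t] are never inspected by [history]. *)
move=> wA; pose X x : {ffun 'I_t.+1 -> {set G}} := [ffun i : 'I_t.+1 => B i x].
pose hh (f : {ffun 'I_t.+1 -> {set G}}) i := f (inord i).
have XE f : [set x | X x = f] = history B t (hh f).
  apply/seteqP; split=> x /=.
    by move=> <- i it; rewrite /hh ffunE inordK.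
  move=> H; apply/ffunP => i; have it : (i <= t)%N by rewrite -ltnS.
  by rewrite ffunE (H i it) /hh inord_val.
have mX f : measurable [set x | X x = f] by rewrite XE; exact: measurable_history.
have mw : measurable [set x | w \in B t.+1 x].
  exact: (measurable_blue _ (fun A => w \in A)).
rewrite (fine_prob_fibers mX (measurableI _ _ (mB t A) mw)).
rewrite /pr (fine_prob_fibers mX (mB t A)) mulr_suml; apply: eq_bigr => f _.
rewrite XE; have [fA|fA] := eqVneq (hh f t) A; last first.
  have e0 : [set x | B t x = A] `&` history B t (hh f) = set0.
    apply/seteqP; split=> x //= [xA /(_ t (leqnn t)) E].
    by move: fA; rewrite -E xA eqxx.
  by rewrite setIAC e0 set0I measure0 mul0r.
have e1 : [set x | B t x = A] `&` history B t (hh f) = history B t (hh f).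
  by apply/seteqP; split=> x /= => [[]//|H]; split=> //; rewrite H.
rewrite setIAC e1.
have Wsub : [set w]%SET \subset ~: hh f t by rewrite finset.sub1set inE fA.
have := rzf_indep hB Wsub; rewrite big_set1 fA.
under eq_set do rewrite finset.sub1set.
move=> ->; rewrite fineM//.
by apply: fin_num_measure; exact: measurable_history.
Qed.

Lemma cover_step t w : cover t.+1 w = \sum_A pr t A * stay_prob A w.
Proof.
have mw : measurable [set x | w \in B t.+1 x].
  exact: (measurable_blue _ (fun A => w \in A)).
rewrite /cover (fine_prob_fibers (mB t) mw); apply: eq_bigr => A _.
rewrite setIC /stay_prob; case: ifPn => [wA|]; last exact: markov_step.
rewrite mulr1; congr (fine (P _)); apply/seteqP; split=> x /= => [[]//|E].
split=> //; have := rzf_mono hB t x; rewrite E => /fintype.subsetP; exact.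
Qed.

(** * Unreachable vertices stay white almost surely *)

Lemma cover_unreachable v : ~ reachable_from S v -> forall t, cover t v = 0.
Proof.
move=> nv t; elim: t v nv => [|t IH] v nv.
  rewrite /cover (_ : [set _ | _] = set0) ?measure0//.
  apply/seteqP; split=> x //=; rewrite (rzf_init hB) => vS.
  by apply: nv; exists v => //; exact: connect0.
(* If all of [A] is reachable, no positive edge joins [A] to [v], so the forcing probability
   vanishes. *)
rewrite cover_step big1// => A _; have [h|] := pselect (forall u, u \in A -> reachable_from S u).
  rewrite /stay_prob ifN; last by apply/negP => /h.
  rewrite force_prob_eq0 ?mulr0// => u /h[s sS su]; apply/negP => uv; apply: nv.
  by exists s => //; exact: connect_trans su (connect1 uv).
(* Otherwise [A] contains an unreachable [u]; the vanishing [cover t u] is a sum of nonnegative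
   terms, one of which is [pr t A]. *)
move=> /existsNP[u /not_implyP[uA /IH]]; rewrite coverE => /eqP.
rewrite psumr_eq0 => [|A' _]; last by rewrite mulr_ge0 ?pr_ge0 ?ler0n.
by move=> /allP/(_ A); rewrite mem_index_enum uA mulr1 => /(_ isT)/eqP ->; rewrite mul0r.
Qed.

(** * Growth of the expected number of blue vertices *)

Lemma cover_progress (q : R) :
  (forall A : {set G}, S \subset A -> A != [set: G]%SET ->
     q <= \sum_(w | w \notin A) force_prob A w) ->
  forall t, q * unfinished t <= \sum_w cover t.+1 w - \sum_w cover t w.
Proof.
move=> hq t.
under eq_bigr do rewrite cover_step.
under [X in _ <= _ - X]eq_bigr do rewrite coverE.
rewrite exchange_big [X in _ - X]exchange_big/= -sumrB.
rewrite /unfinished (_ : [set _ | _] = [set x | B t x != [set: G]%SET]); last first.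
  by apply/seteqP; split=> x /= => /eqP.
rewrite (pr_set t (fun A => A != [set: G]%SET)) mulr_sumr big_mkcond/=.
apply: ler_sum => A _; rewrite -!mulr_sumr -mulrBr sum_stay_prob.
have -> : \sum_(w : G) (w \in A)%:R = #|A|%:R :> R.
  rewrite -natr_sum -sum1_card; congr (_%:R); rewrite [RHS]big_mkcond.
  by apply: eq_bigr => w _; case: ifP.
rewrite addrAC subrr add0r.
case: ifP => AT; last by rewrite mulr_ge0 ?pr_ge0// sumr_ge0// => w _; exact: force_prob_ge0.
(* The bound by [q] is available only for [A] containing [S]; any other [A] has probability zero. *)
have [SA|/pr_eq0 ->] := boolP (S \subset A); last by rewrite mulr0 mul0r.
by rewrite mulrC ler_wpM2l ?pr_ge0// hq.
Qed.

Lemma unfinished_sum_bound : (forall v, reachable_from S v) ->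
  exists M : R, forall N, \sum_(0 <= t < N) unfinished t <= M.
Proof.
move=> hr; pose r (A : {set G}) := \sum_(w | w \notin A) force_prob A w.
pose Q := [pred A : {set G} | (S \subset A) && (A != [set: G]%SET)].
have r0 A : Q A -> 0 < r A.
  move=> /andP[SA AT]; have [w wA fw] := reachable_progress hr SA AT.
  by rewrite /r (bigD1 w)//= ltr_pwDl// sumr_ge0// => u _; exact: force_prob_ge0.
(* The default 1 keeps [q] positive even when no set satisfies [Q], as when [S] is all of [G]. *)
pose q := \big[Num.min/1]_(A | Q A) r A.
have q0 : 0 < q by rewrite /q; elim/big_ind: _ => // x y x0 y0; rewrite lt_min x0.
have hq (A : {set G}) : S \subset A -> A != [set: G]%SET -> q <= r A.
  by move=> SA AT; apply: bigmin_le_cond; apply/andP.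
have c1 N w : 0 <= cover N w <= 1.
  have mw : measurable [set x | w \in B N x] by exact: (measurable_blue _ (fun A => w \in A)).
  rewrite fine_ge0//= -[leRHS]/(fine 1%E) fine_le ?fin_num_measure//.
  exact: probability_le1.
exists (#|G|%:R / q) => N; rewrite ler_pdivlMr// mulrC mulr_sumr.
apply: le_trans (ler_sum _ (fun t _ => cover_progress hq t)) _.
rewrite telescope_sumr//.
have s0 : 0 <= \sum_w cover 0 w by apply: sumr_ge0 => w _; case/andP: (c1 0%N w).
apply: le_trans (_ : \sum_w cover N w <= _); first by rewrite gerBl.
rewrite -sum1_card natr_sum; apply: ler_sum => w _.
by case/andP: (c1 N w).
Qed.

(** * The propagation time as a series *)

Lemma prop_timeE x : prop_time B x =
  (\sum_(0 <= t <oo) (\1_[set x | B t x <> [set: G]%SET] x)%:E)%E.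
Proof.
have nn t : (0 <= (\1_[set x | B t x <> [set: G]%SET] x : R)%:E)%E by rewrite lee_fin.
have i1 t : B t x <> [set: G]%SET -> \1_[set x | B t x <> [set: G]%SET] x = 1 :> R.
  by move=> h; rewrite indicE mem_set.
have i0 t : B t x = [set: G]%SET -> \1_[set x | B t x <> [set: G]%SET] x = 0 :> R.
  by move=> h; rewrite indicE memNset//=; apply.
(* The series counts the unfinished rounds. By monotonicity these are exactly the rounds before the
   first finishing round [m]; if there is none, every term is 1 and both sides are infinite. *)
have [[t0 ht0]|nt] := pselect (exists t, B t x = [set: G]%SET).
  have ex : exists t, B t x == [set: G]%SET by exists t0; apply/eqP.
  have [m /eqP hm mmin] := ex_minnP ex.
  have later t : (m <= t)%N -> B t x = [set: G]%SET.
    by move=> mt; apply/eqP; rewrite -finset.subTset -hm blue_sub.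
  have earlier t : (t < m)%N -> B t x <> [set: G]%SET.
    by move=> tm /eqP/mmin; rewrite leqNgt tm.
  rewrite (nneseries_split 0 m)// add0n eseries0 ?adde0; last first.
    by move=> t mt _; rewrite i0 ?later.
  rewrite sumEFin big_mkord (eq_bigr (fun=> 1)); last by move=> t _; rewrite i1//; exact: earlier.
  rewrite sumr_const card_ord; apply/eqP; rewrite eq_le; apply/andP; split.
    by apply: ereal_inf_lbound; exists m.
  by apply: le_ereal_inf_tmp => _ [t /= ht <-]; rewrite lee_fin ler_nat mmin//; apply/eqP.
rewrite /prop_time (_ : [set t | _] = set0); last first.
  by apply/seteqP; split=> t //= ht; apply: nt; exists t.
rewrite image_set0 ereal_inf0; apply/esym/eq_infty => r.
apply: le_trans (nneseries_lim_ge (Num.bound `|r|) _) => //.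
rewrite sumEFin big_mkord (eq_bigr (fun=> 1)); last first.
  by move=> t _; rewrite i1// => ht; apply: nt; exists t.
rewrite sumr_const card_ord lee_fin (le_trans (ler_norm _))//.
by rewrite ltW// archi_boundP.
Qed.

(** The tail-sum formula for an expectation: the terms are nonnegative, so integral and series
    commute, infinite values included. *)
Lemma integral_prop_time :
  (\int[P]_x prop_time B x = \sum_(0 <= t <oo) (unfinished t)%:E)%E.
Proof.
have mU t : measurable [set x | B t x <> [set: G]%SET].
  exact: (measurable_blue t (fun A => A <> [set: G]%SET)).
under eq_integral do rewrite prop_timeE.
rewrite integral_nneseries//; last first.
  move=> t; apply/measurable_realfun.measurable_EFinP.
  exact: measurable_realfun.measurable_indic.
apply: eq_eseriesr => t _; rewrite integral_indic// setIT /unfinished fineK//.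
exact: fin_num_measure.
Qed.

(** * Probability of finishing and finiteness of the expectation *)

Lemma finish_gt0 : (forall v, reachable_from S v) ->
  (0 < P [set x | exists t, B t x = [set: G]%SET])%E.
Proof.
move=> hr; rewrite lt0e measure_ge0 andbT; apply/eqP => P0.
have mE : measurable [set x | exists t, B t x = [set: G]%SET].
  rewrite (_ : [set _ | _] = \bigcup_t [set x | B t x = [set: G]%SET]).
    by apply: bigcupT_measurable => t; exact: mB.
  by apply/seteqP; split=> x [t]; exists t.
(* Were finishing a null event, every tail probability would be 1, and the partial sums would
   outgrow the bound [M]. *)
have u1 t : unfinished t = 1.
  have mU := measurable_blue t (fun A => A <> [set: G]%SET).
  rewrite -[RHS]/(fine 1%E) /unfinished; congr fine; apply/eqP.
  rewrite eq_le probability_le1//=.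
  rewrite -[X in (X <= _)%E]sube0 -P0 -probability_setC//.
  apply: le_measure; rewrite ?inE//; first exact: measurableC.
  by move=> x /= h ht; apply: h; exists t.
have [M] := unfinished_sum_bound hr.
move=> /(_ (Num.bound `|M|)); rewrite big_mkord (eq_bigr (fun=> 1)) => [|t _]; last exact: u1.
rewrite sumr_const card_ord => NM.
by have := archi_boundP (normr_ge0 M); rewrite ltNge (le_trans NM)// ler_norm.
Qed.

Lemma ept_fin : (forall v, reachable_from S v) -> (ept_rzf P B < +oo)%E.
Proof.
move=> hr; rewrite /ept_rzf finish_gt0// integral_prop_time.
have [M hM] := unfinished_sum_bound hr.
apply: le_lt_trans (ltry M); apply: lime_le.
  by apply: is_cvg_nneseries => t _ _; rewrite lee_fin fine_ge0.
by apply: nearW => N; rewrite sumEFin lee_fin.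
Qed.

(** Finishing at round [t] forces [v] to be blue then, a null event; a countable union over [t]
    remains null. *)
Lemma finish_eq0 v : ~ reachable_from S v ->
  P [set x | exists t, B t x = [set: G]%SET] = 0%E.
Proof.
move=> nv.
have -> : [set x | exists t, B t x = [set: G]%SET] =
    \bigcup_t [set x | B t x = [set: G]%SET].
  by apply/seteqP; split=> x [t]; exists t.
apply: measure_negligible; first by apply: bigcupT_measurable => t; exact: mB.
apply: negligible_bigcup => t; apply/negligibleP; first exact: mB.
have mv : measurable [set x | v \in B t x].
  exact: (measurable_blue _ (fun A => v \in A)).
apply: (subset_measure0 (mB t _) mv); first by move=> x /= ->; rewrite inE.
by rewrite -[LHS]fineK ?fin_num_measure// -/(cover t v) cover_unreachable.
Qed.

End Process.

Theorem theorem2p1 (R : realType) (G : wdigraph R) (S : {set G})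
    (d : measure_display) (T : measurableType d) (P : probability T R)
    (B : nat -> T -> {set G}) (hB : is_rzf_process P B S) :
  (ept_rzf P B < +oo)%E <-> forall v : G, reachable_from S v.
Proof.
split; last exact: ept_fin.
move=> fin v; apply: contrapT => nv; move: fin.
(* With finishing probability zero, [ept_rzf] takes the value [+oo]. *)
by rewrite /ept_rzf (finish_eq0 hB nv) !Order.POrderTheory.ltxx.
Qed.
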